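(* Let $X$ be a finite set with $|X|\ge 3$ and let $\mathcal S$ be a split system on $X$. Then $\mathcal S$ is injective if and only if $\mathcal S$ 4-dices, 5-dices and 6-dices $X$.
   Context: Let $X$ be a finite set with $|X|\ge 3$. A split of $X$ is an unordered bipartition $A|B=B|A$ of $X$ into two non-empty disjoint subsets (its parts) with $A\cup B=X$. Its size is $\min\{|A|,|B|\}$; a split of size $r$ is called an $r$-split, and a split of size 1 is called trivial. A split system on $X$ is a set $\mathcal S$ of splits of $X$ that contains all trivial splits $\{x\}|X-\{x\}$, $x\in X$. For $S\in\mathcal S$ and $x\in X$, $S(x)$ denotes the part of $S$ containing $x$. The Buneman graph $\mathcal B(\mathcal S)$ has as vertices all maps $\phi:\mathcal S\to\mathcal P(X)$ such that (B1) $\phi(S)\in S$ for all $S\in\mathcal S$, and (B2) $\phi(S)\cap\phi(S')\ne\emptyset$ for all distinct $S,S'\in\mathcal S$. Two vertices $\phi,\phi'$ are adjacent if there is a unique $S\in\mathcal S$ with $\phi(S)\neq\phi'(S)$. For $x\in X$, $\phi_x$ denotes the vertex $S\mapsto S(x)$. It is known that $\mathcal B(\mathcal S)$ is a median graph, i.e. it is connected and any three vertices $u,v,w$ have a unique median (a vertex lying on shortest paths between each pair of $u,v,w$). For $Y=\{x,y,z\}\in\binom X3$, $\phi_Y$ denotes the median of $\phi_x,\phi_y,\phi_z$ in $\mathcal B(\mathcal S)$. The split system $\mathcal S$ is injective if $\phi_Y\ne\phi_{Y'}$ for all distinct $Y,Y'\in\binom X3$. For $Y\subseteq X$ with $|Y|\ge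 3$, the restriction $\mathcal S|_Y$ is the split system on $Y$ consisting of all splits $S|_Y=(A\cap Y)|(B\cap Y)$ with $S=A|B\in\mathcal S$ (and both $A\cap Y$, $B\cap Y$ non-empty). $\mathcal S$ 4-dices $X$ if $|X|<4$ or, for all $Y\in\binom X4$, $\mathcal S|_Y$ contains at least two 2-splits. $\mathcal S$ 5-dices $X$ if $|X|<5$ or, for all $Y\in\binom X5$, $\mathcal S|_Y$ contains at least five 2-splits. $\mathcal S$ 6-dices $X$ if $|X|<6$ or, for all $Y\in\binom X6$, $\mathcal S|_Y$ contains at least one 3-split or a triangle of 2-splits, that is, three 2-splits of the form $\{x,y\}|Y-\{x,y\}$, $\{x,z\}|Y-\{x,z\}$, $\{y,z\}|Y-\{y,z\}$ with $x,y,z\in Y$ distinct. *)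

(* Defs.v *)
From mathcomp Require Import all_boot.

Set Implicit Arguments.
Unset Strict Implicit.
Unset Printing Implicit Defensive.

(** A split [A|B] of a ground set [Y] is encoded as the set [{A, B}] of its two
    parts, so that [A|B] and [B|A] are the same object; the part of [S] containing
    [x] is [pblock S x]. *)
Definition is_split (T : finType) (Y : {set T}) (S : {set {set T}}) : bool :=
  partition S Y && (#|S| == 2).

(** [#|cover S|], the cardinality of the ground set, is only the neutral element
    of the minimum. *)
Definition split_size (T : finType) (S : {set {set T}}) : nat :=
  \big[minn/#|cover S|]_(A in S) #|A|.

Definition part_split (T : finType) (Y A : {set T}) : {set {set T}} :=
  [set A; Y :\: A].

Record split_system (X : finType) := SplitSystem {
  splits : {set {set {set X}}};
  splits_split : forall S, S \in splits -> is_split [set: X] S;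
  splits_trivial : forall x, part_split [set: X] [set x] \in splits
}.

Section Graph.

Variables (V : finType) (e : rel V).

(** As is standard for [path], the walk is [u :: p] and has length [size p]. *)
Definition is_walk (u v : V) (p : seq V) : Prop := path e u p /\ last u p = v.

Definition shortest_path (u v : V) (p : seq V) : Prop :=
  is_walk u v p /\ forall q, is_walk u v q -> size p <= size q.

Definition on_shortest_path (u v m : V) : Prop :=
  exists2 p, shortest_path u v p & m \in u :: p.

Definition is_median (u v w m : V) : Prop :=
  [/\ on_shortest_path u v m, on_shortest_path v w m & on_shortest_path u w m].

End Graph.

Section Buneman.

Variables (X : finType) (SS : split_system X).

Definition split_in : finType := {S : {set {set X}} | S \in splits SS}.

Definition is_buneman_vertex (phi : {ffun split_in -> {set X}}) : bool :=
  [forall S, phi S \in val S] &&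
  [forall S, forall S', (S != S') ==> (phi S :&: phi S' != set0)].

Definition buneman_vertex : finType :=
  {phi : {ffun split_in -> {set X}} | is_buneman_vertex phi}.

Definition buneman_adj : rel buneman_vertex :=
  fun phi psi => #|[set S | val phi S != val psi S]| == 1.

Definition point_map (x : X) : {ffun split_in -> {set X}} :=
  [ffun S => pblock (val S) x].

Lemma mem_point_map x S : x \in point_map x S.
Proof.
rewrite ffunE mem_pblock.
by have /andP[/cover_partition -> _] := splits_split (valP S); rewrite inE.
Qed.

Lemma point_map_vertex x : is_buneman_vertex (point_map x).
Proof.
apply/andP; split; last first.
  apply/forallP=> S; apply/forallP=> S'; apply/implyP=> _.
  by apply/set0Pn; exists x; rewrite inE !mem_point_map.
apply/forallP=> S; rewrite ffunE pblock_mem //.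
by have /andP[/cover_partition -> _] := splits_split (valP S); rewrite inE.
Qed.

Definition point_vertex (x : X) : buneman_vertex :=
  exist _ (point_map x) (point_map_vertex x).

(** Graph distance in the Buneman graph is the number of splits on which two
    vertices differ, whence existence and uniqueness of medians. *)
Definition diffs (u v : buneman_vertex) : {set split_in} :=
  [set S | val u S != val v S].

Lemma vertex_in (u : buneman_vertex) S : val u S \in val S.
Proof. by have /andP[/forallP/(_ S)] := valP u. Qed.

Lemma vertex_meet (u : buneman_vertex) S S' :
  S != S' -> exists x, (x \in val u S) && (x \in val u S').
Proof.
have /andP[_ /forallP/(_ S)/forallP/(_ S')/implyP h] := valP u.
by move=> /h /set0Pn[x]; rewrite inE; exists x.
Qed.

Lemma parts2 (S : split_in) A B C : A \in val S -> B \in val S ->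
  A != B -> C \in val S -> C = A \/ C = B.
Proof.
move=> AS BS AB CS; have /andP[_ /eqP S2] := splits_split (valP S).
have SE : [set A; B] = val S.
  apply/eqP; rewrite eqEcard cards2 AB S2 andbT.
  by apply/subsetP=> D; rewrite !inE => /orP[] /eqP ->.
by move: CS; rewrite -SE !inE => /orP[] /eqP; [left|right].
Qed.

Lemma part_compl (S : split_in) A B x : A \in val S -> B \in val S ->
  A != B -> (x \in B) = (x \notin A).
Proof.
move=> AS BS AB; have /andP[pS _] := splits_split (valP S).
have /and3P[/eqP cS tS _] := pS.
have := in_setT x; rewrite -cS => /bigcupP[C CS xC].
have /trivIsetP/(_ _ _ AS BS AB) dAB := tS.
have nAB : ~ (x \in A /\ x \in B).
  by case=> xA xB; move: (disjointFr dAB xA); rewrite xB.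
case: (parts2 AS BS AB CS) xC => -> xC.
  by rewrite xC /=; apply/negP=> xB; apply: nAB.
by rewrite xC; apply/esym/negP=> xA; apply: nAB.
Qed.

Lemma diffs_triangle u v w : diffs u w \subset diffs u v :|: diffs v w.
Proof.
apply/subsetP=> S; rewrite !inE -negb_and; apply: contra.
by move=> /andP[/eqP-> /eqP->].
Qed.

Lemma walk_diffs u p : path buneman_adj u p -> #|diffs u (last u p)| <= size p.
Proof.
elim: p u => [|v p IH] u /=.
  by move=> _; rewrite leqn0 cards_eq0; apply/eqP/setP=> S; rewrite !inE eqxx.
case/andP=> /eqP uv /IH h; apply: leq_trans (subset_leq_card (diffs_triangle u v _)) _.
apply: leq_trans (leq_card_setU _ _) _.
by rewrite -[in leqRHS]add1n leq_add // /diffs uv.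
Qed.

Lemma diffs_step u v S0 : S0 \in diffs u v ->
  exists2 u', buneman_adj u u' & #|diffs u' v| = #|diffs u v|.-1.
Proof.
move=> S0d.
pose S := [arg min_(S < S0 | S \in diffs u v) #|val u S|].
have [Sd Smin] : S \in diffs u v /\
    forall S', S' \in diffs u v -> #|val u S| <= #|val u S'|.
  by rewrite /S; case: arg_minnP.
have uvS : val u S != val v S by move: Sd; rewrite inE.
pose f : {ffun split_in -> {set X}} :=
  [ffun T => if T == S then val v S else val u T].
have meetS T : T != S -> val v S :&: val u T != set0.
  move=> TS; have [Td|] := boolP (T \in diffs u v); last first.
    rewrite inE negbK => /eqP ->; have [x /andP[x1 x2]] := vertex_meet v TS.
    by apply/set0Pn; exists x; rewrite inE x1 x2.
  apply/eqP=> h0.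
  have sTS : val u T \subset val u S.
    apply/subsetP=> x xT; apply: contraT => xS.
    have : x \in val v S :&: val u T.
      by rewrite inE xT (part_compl _ (vertex_in u S) (vertex_in v S) uvS) xS.
    by rewrite h0 inE.
  have ETS : val u T = val u S by apply/eqP; rewrite eqEcard sTS Smin.
  have uT := vertex_in u T; have vT := vertex_in v T.
  have uvT : val u T != val v T by move: Td; rewrite inE.
  have uS := vertex_in u S; have vS := vertex_in v S.
  have Evv : val v T = val v S.
    apply/setP=> x; rewrite (part_compl x uT vT uvT) (part_compl x uS vS uvS).
    by rewrite ETS.
  have ES : val T = val S.
    apply/setP=> C; apply/idP/idP=> CS.
      by case: (parts2 uT vT uvT CS) => ->; rewrite ?ETS ?Evv.
    by case: (parts2 uS vS uvS CS) => ->; rewrite -?ETS -?Evv.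
  by move/eqP: TS; apply; apply: val_inj.
have fP : is_buneman_vertex f.
  apply/andP; split.
    by apply/forallP=> T; rewrite ffunE; case: (T =P S) => [->|_]; apply: vertex_in.
  apply/forallP=> T; apply/forallP=> T'; apply/implyP=> TT'.
  rewrite !ffunE; case: (eqVneq T S) => TS; case: (eqVneq T' S) => TS'.
  - by move: TT'; rewrite TS TS' eqxx.
  - exact: meetS.
  - by rewrite setIC meetS.
  - have [x /andP[x1 x2]] := vertex_meet u TT'.
    by apply/set0Pn; exists x; rewrite inE x1 x2.
exists (exist _ f fP).
  rewrite /buneman_adj; apply/cards1P; exists S; apply/setP=> T.
  by rewrite !inE /= ffunE; case: (T =P S) => [->|_]; rewrite ?eqxx.
rewrite [in RHS](cardsD1 S) Sd /=; congr #|pred_of_set _|; apply/setP=> T.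
by rewrite !inE /= ffunE; case: (T =P S) => [->|_] //=; rewrite eqxx.
Qed.

Lemma geodesic u v : exists2 p, is_walk buneman_adj u v p & size p = #|diffs u v|.
Proof.
have [n] := ubnP #|diffs u v|; elim: n u => // n IH u.
have [d0|[S Sd]] := set_0Vmem (diffs u v).
  move=> _; exists [::]; last by rewrite d0 cards0.
  split=> //=; apply/val_inj/ffunP=> S; apply/eqP.
  by have /setP/(_ S) := d0; rewrite !inE => /negbFE.
have [u' uu' du'] := diffs_step Sd; have d_gt0 : 0 < #|diffs u v|.
  by apply/card_gt0P; exists S.
move=> dn; have [|p [pp lp] sp] := IH u'; first by rewrite du' prednK.
by exists (u' :: p); [split; rewrite //= uu'|rewrite /= sp du' prednK].
Qed.

Lemma on_shortest_pathP u v m : on_shortest_path buneman_adj u v m <->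
  forall S, val m S = val u S \/ val m S = val v S.
Proof.
split=> [[p [[pp lp] pmin] mp] S|btw].
  have [q qw sq] := geodesic u v; have := pmin q qw; rewrite sq.
  case/splitPl: mp pp lp {pmin} => p1 p2 lm.
  rewrite cat_path last_cat lm size_cat => /andP[pp1 pp2] lp dle.
  have := walk_diffs pp1; have := walk_diffs pp2; rewrite lm lp => d2 d1.
  have le1 := leq_trans (leq_add d1 d2) dle.
  have [->|mu] := eqVneq (val m S) (val u S); first by left.
  have [->|mv] := eqVneq (val m S) (val v S); first by right.
  have := leq_trans le1 (subset_leq_card (diffs_triangle u m v)).
  rewrite -cardsUI -[leqRHS]addn0 leq_add2l leqn0 cards_eq0 => /eqP/setP/(_ S).
  by rewrite !inE eq_sym mu mv.
have [p [pp lp] sp] := geodesic u m; have [q [pq lq] sq] := geodesic m v.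
exists (p ++ q); last by rewrite -cat_cons mem_cat -lp mem_last.
split; first by split; rewrite ?cat_path ?last_cat lp ?pp.
move=> r [pr lr]; have := walk_diffs pr; rewrite lr; apply: leq_trans.
rewrite size_cat sp sq -cardsUI.
have -> : diffs u m :&: diffs m v = set0.
  by apply/setP=> S; rewrite !inE; case: (btw S) => ->; rewrite eqxx ?andbF.
rewrite cards0 addn0; apply/subset_leq_card/subsetP=> S; rewrite !inE.
by case: (btw S) => ->; rewrite eqxx ?orbF.
Qed.

Lemma median_unique_exists u v w : exists! m, is_median buneman_adj u v w m.
Proof.
pose f : {ffun split_in -> {set X}} :=
  [ffun S => if val u S == val v S then val u S else val w S].
have fE S : [\/ f S = val u S /\ f S = val v S, f S = val u S /\ f S = val w S
              | f S = val v S /\ f S = val w S].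
  rewrite ffunE; case: eqP => [uv|/eqP uv]; first by constructor 1.
  case: (parts2 (vertex_in u S) (vertex_in v S) uv (vertex_in w S)) => <-.
    by constructor 2.
  by constructor 3.
have fP : is_buneman_vertex f.
  apply/andP; split.
    by apply/forallP=> S; case: (fE S) => -[-> _]; apply: vertex_in.
  apply/forallP=> S; apply/forallP=> S'; apply/implyP=> SS'.
  have meet (t : buneman_vertex) : f S = val t S -> f S' = val t S' ->
      f S :&: f S' != set0.
    move=> -> ->; have [x /andP[x1 x2]] := vertex_meet t SS'.
    by apply/set0Pn; exists x; rewrite inE x1 x2.
  by case: (fE S) => -[a b]; case: (fE S') => -[c d];
    first [exact: meet a c|exact: meet a d|exact: meet b c|exact: meet b d].
exists (exist _ f fP); split.
  by split; apply/on_shortest_pathP=> S /=; case: (fE S) => -[];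
    by [left|right].
move=> m [/on_shortest_pathP uv /on_shortest_pathP vw /on_shortest_pathP uw].
apply/val_inj/ffunP=> S /=; rewrite ffunE.
case: eqP => [E|nE]; first by case: (uv S) => ->.
by case: (vw S) => // mv; case: (uw S) => // mu; case: nE; rewrite -mu -mv.
Qed.

(** [m] is the vertex [phi_Y], for [Y] a 3-subset; see [median_unique_exists]
    for existence and uniqueness of medians. *)
Definition is_triple_median (Y : {set X}) (m : buneman_vertex) : Prop :=
  exists x y z, Y = [set x; y; z] /\
    is_median buneman_adj (point_vertex x) (point_vertex y) (point_vertex z) m.

Definition injective_system : Prop :=
  forall Y Y' : {set X}, #|Y| = 3 -> #|Y'| = 3 -> Y <> Y' ->
  forall m m', is_triple_median Y m -> is_triple_median Y' m' -> m <> m'.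

Definition restriction (Y : {set X}) : {set {set {set X}}} :=
  [set [set A :&: Y | A in (S : {set {set X}})] |
     S in splits SS & [forall A in (S : {set {set X}}), A :&: Y != set0]].

Definition restricted_rsplits (r : nat) (Y : {set X}) : {set {set {set X}}} :=
  [set S in restriction Y | split_size S == r].

Definition dices4 : Prop :=
  #|X| < 4 \/
  forall Y : {set X}, #|Y| = 4 -> 2 <= #|restricted_rsplits 2 Y|.

Definition dices5 : Prop :=
  #|X| < 5 \/
  forall Y : {set X}, #|Y| = 5 -> 5 <= #|restricted_rsplits 2 Y|.

Definition has_triangle (Y : {set X}) : Prop :=
  exists x y z, [/\ [/\ x \in Y, y \in Y & z \in Y],
    [/\ x != y, x != z & y != z]
    & [/\ part_split Y [set x; y] \in restricted_rsplits 2 Y,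
          part_split Y [set x; z] \in restricted_rsplits 2 Y
        & part_split Y [set y; z] \in restricted_rsplits 2 Y]].

Definition dices6 : Prop :=
  #|X| < 6 \/
  forall Y : {set X}, #|Y| = 6 ->
    1 <= #|restricted_rsplits 3 Y| \/ has_triangle Y.

End Buneman.

(* Main.v *)
Require Import Defs.
From mathcomp Require Import all_boot.

Set Implicit Arguments.
Unset Strict Implicit.
Unset Printing Implicit Defensive.

(** For a triple [Y], the median [phi_Y] picks in each split the part containing
    at least two points of [Y], so the system is injective iff any two distinct
    triples are told apart by majority on some split.  Two distinct triples span
    4, 5 or 6 points.  On 4 points [a, b, c, d], the triples [abc] and [abd] are
    separated iff there is a 2-split other than [ab|cd].  On 5 points, 2-splits
    are the edges of a graph; separation of all pairs of triples says that every
    4-cycle contains an edge (triples sharing two points) and that no 4-cycle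
    contains all edges (triples sharing one point), which forces 5 edges, while
    5 edges never fit into a 4-cycle.  On 6 points, a 3-split separates every two
    complementary triples; without 3-splits, separation says that the graph of
    2-splits is not bipartite along the two triples, which together with the
    separation of intersecting triples forces a triangle.  The statements about
    graphs on at most 6 vertices are checked by evaluation. *)

(** * Splits and triples as bit sequences *)

Fixpoint bitseqs n : seq bitseq :=
  if n is n'.+1 then
    map (cons true) (bitseqs n') ++ map (cons false) (bitseqs n')
  else [:: [::]].

Definition weight (m : bitseq) := minn (count id m) (count negb m).

(** Relative to an enumeration [s] of the ground set, the [bitseq] [m] stands for
    the split into [mask m s] and its complement; taking the part that contains
    the first point represents each split once. *)
Definition split_masks n r :=
  [seq m <- map (cons true) (bitseqs n.-1) | weight m == r].

(** For a triple marked by [k], this says that its median picks the part marked by [m]. *)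
Definition majority (k m : bitseq) := 1 < count id (mask k m).

Definition triples n := [seq k <- bitseqs n | count id k == 3].

(** Each constraint is a [bitseq] over [split_masks n 2] marking the splits which
    separate a given pair of triples. *)
Definition separators n :=
  undup [seq [seq majority k m != majority k' m | m <- split_masks n 2]
            | k <- triples n, k' <- [seq k' <- triples n | k != k']].

(** [m] is constant outside the triple [k] iff its 2-element part is an edge of the
    triangle on [k]. *)
Definition triangles n :=
  [seq [seq constant (mask (map negb k) m) | m <- split_masks n 2]
     | k <- triples n].

(** With [w] marking the 2-splits present, [w] is a hitting set of the family [cs]; in [fills], [w]
    contains a member of [cs]. *)
Definition hits (cs : seq bitseq) (w : bitseq) :=
  all (fun c => has id (mask c w)) cs.

Definition fills (cs : seq bitseq) (w : bitseq) :=
  has (fun c => all id (mask c w)) cs.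

(** The conditional, unlike a boolean connective, spares the call-by-value
    evaluation of [hits]. *)
Definition checks n (cs : seq bitseq) (P : pred bitseq) :=
  all (fun w => if P w then true else ~~ hits cs w) (bitseqs n).

(** * Membership in the enumerations *)

Lemma mem_bitseqs n m : (m \in bitseqs n) = (size m == n).
Proof.
elim: n m => [|n IH] [|b m] //=; rewrite mem_cat.
  by apply/negbTE; rewrite negb_or; apply/andP; split; apply/mapP=> -[].
have inj c : injective (cons c) by move=> ? ? [].
have ninj c l : (c :: m \in map (cons (~~ c)) l) = false.
  by apply/negP=> /mapP[l' _ /(congr1 (head c))] /=; case: (c).
rewrite eqSS -IH; have := ninj b; case: b => /= ->; rewrite ?orbF mem_map //;
  exact: inj.
Qed.

Lemma bitseqs_uniq n : uniq (bitseqs n).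
Proof.
elim: n => //= n IH; rewrite cat_uniq !map_inj_uniq ?IH /=; try by move=> ? ? [].
rewrite andbT; apply/hasPn=> m /mapP[x _ ->].
by apply/mapP=> -[].
Qed.

Lemma mem_split_masks n r m : 0 < n ->
  (m \in split_masks n r) = [&& size m == n, head false m & weight m == r].
Proof.
case: n => // n _; rewrite mem_filter andbA andbC; congr (_ && _).
case: m => [|b m]; first by apply/negbTE/negP=> /mapP[].
case: b; last by rewrite andbF; apply/negbTE/negP=> /mapP[].
by rewrite andbT eqSS -mem_bitseqs mem_map // => ? ? [].
Qed.

Lemma split_masks_uniq n r : uniq (split_masks n r).
Proof. by rewrite filter_uniq // map_inj_uniq ?bitseqs_uniq // => ? ? []. Qed.

Lemma mem_triples n k : (k \in triples n) = (count id k == 3) && (size k == n).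
Proof. by rewrite mem_filter mem_bitseqs. Qed.

(** * Finite checks of the graph statements *)

Lemma checksP n cs P w : checks n cs P -> size w = n -> hits cs w -> P w.
Proof.
by move=> /allP/(_ w); rewrite mem_bitseqs => h /eqP /h; case: (P w) => // /negP.
Qed.

(** There are 3, 10 and 15 2-splits on 4, 5 and 6 points, so each evaluation ranges over all sets of
    2-splits. *)
Lemma checks4 : checks 3 (separators 4) (fun w => 1 < count id w).
Proof. by vm_compute. Qed.

Lemma checks5 : checks 10 (separators 5) (fun w => 4 < count id w).
Proof. by vm_compute. Qed.

Lemma checks6 : checks 15 (separators 6) (fills (triangles 6)).
Proof. by vm_compute. Qed.

(** * Majorities and weights *)

Lemma mask_mapb (T : Type) (p q : pred T) s :
  mask (map q s) (map p s) = map p (filter q s).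
Proof. by rewrite -map_mask -filter_mask. Qed.

(** Of two complementary parts, exactly one holds at least two of three given points. *)
Lemma majority_negb k m : size k = size m -> count id k = 3 ->
  majority k (map negb m) = ~~ majority k m.
Proof.
move=> km k3; rewrite /majority -map_mask count_map.
have : count id (mask k m) + count negb (mask k m) = 3.
  by rewrite (count_predC id) size_mask.
by case: (count id _) => [|[|[|[|?]]]] //; case: (count _ _) => [|[|[|[|?]]]].
Qed.

Lemma majority_count k m : majority k m -> 1 < count id m.
Proof. by move/leq_trans; apply; rewrite leq_count_subseq // mask_subseq. Qed.

(** One triple has its majority in [m] and the other in the complement, so both parts have at least
    two points. *)
Lemma weight_separating k k' m : size k = size m -> size k' = size m ->
  count id k = 3 -> count id k' = 3 -> majority k m != majority k' m ->
  1 < weight m.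
Proof.
wlog km : k k' / majority k m => [h s s' c c' kk'|].
  have [km|/negbTE nkm] := boolP (majority k m); first exact: (h k k').
  by apply: (h k' k); rewrite // 1?eq_sym //; move: kk'; rewrite nkm; case: majority.
move=> s s' c c'; rewrite km leq_min (majority_count km) /= => nk'm.
have -> : count negb m = count id (map negb m) by rewrite count_map.
apply: (@majority_count k').
by rewrite majority_negb //; case: (majority k' m) nk'm.
Qed.

Lemma weight_double m : (weight m).*2 <= size m.
Proof.
rewrite -(count_predC id) -addnn; apply: leq_add; [exact: geq_minl|exact: geq_minr].
Qed.

Lemma weight_negb m : weight (map negb m) = weight m.
Proof.
by rewrite /weight !count_map minnC; congr minn; apply: eq_count => -[].
Qed.

Lemma map_mem_mask (T : eqType) (s : seq T) m : uniq s -> size m = size s ->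
  map (mem (mask m s)) s = m.
Proof.
elim: s m => [|x s IH] [|b m] //= /andP[xs us] [sm]; congr (_ :: _).
  case: b; rewrite ?inE ?eqxx //; apply/negbTE.
  by apply: contra xs; apply: mem_mask.
rewrite -[RHS](IH m) //; apply/eq_in_map=> y ys /=.
by case: b => //; rewrite inE; case: eqP => // yx; rewrite -yx ys in xs.
Qed.

Lemma mask_negb_notin (T : eqType) (s : seq T) k x : uniq s -> size k = size s ->
  x \in mask k s -> x \notin mask (map negb k) s.
Proof.
move=> us sk; rewrite !in_mask // => /andP[xs xk].
by rewrite xs (nth_map false) ?sk ?index_mem // xk.
Qed.

(** * Traces of the parts of splits on a list of points *)

Section Sides.

Variables (X : finType) (SS : split_system X).

Definition side (B : {set X}) := [exists S in splits SS, B \in S].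

Definition shows (s : seq X) (m : bitseq) :=
  [exists B, side B && (map (mem B) s == m)].

(** For triples, [B] is a part picked by exactly one of the two medians. *)
Definition separated (t t' : seq X) :=
  exists2 B, side B & (1 < count (mem B) t) != (1 < count (mem B) t').

Lemma showsP s m : reflect (exists2 B, side B & map (mem B) s = m) (shows s m).
Proof.
apply: (iffP existsP) => [[B /andP[sB /eqP mB]]|[B sB mB]]; exists B => //.
by rewrite sB mB eqxx.
Qed.

Lemma split_sides S B : S \in splits SS -> B \in S -> S = [set B; ~: B].
Proof.
move=> SX BS; have /andP[pS /cards2P[C [D [CD SE]]]] := splits_split SX.
have CDc : D = ~: C.
  apply/setP=> x.
  have h := @part_compl X SS (exist _ S SX) C D x; rewrite inE h //=.
  - by rewrite SE set21.
  - by rewrite SE set22.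
by move: BS; rewrite SE CDc !inE => /orP[] /eqP ->; rewrite // setCK setUC.
Qed.

Lemma sideP B : reflect ([set B; ~: B] \in splits SS) (side B).
Proof.
apply: (iffP existsP) => [[S /andP[SX BS]]|h].
  by rewrite -(split_sides SX BS).
by exists [set B; ~: B]; rewrite h set21.
Qed.

Lemma sideC B : side B -> side (~: B).
Proof. by move/sideP=> h; apply/sideP; rewrite setCK setUC. Qed.

Lemma shows_negb s m : shows s m -> shows s (map negb m).
Proof.
case/showsP=> B sB <-; apply/showsP; exists (~: B); first exact: sideC.
by rewrite -map_comp; apply: eq_map => x /=; rewrite inE.
Qed.

(** * Split sizes and restricted splits *)

Lemma leq_split_size (S : {set {set X}}) n :
  (n <= split_size S) = (n <= #|cover S|) && [forall A in S, n <= #|A|].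
Proof.
have -> : [forall A in S, n <= #|A|] =
    all (fun A : {set X} => (A \in S) ==> (n <= #|A|)) (index_enum _).
  by apply/forallP/allP => h A //; apply: h; rewrite mem_index_enum.
rewrite /split_size; elim: (index_enum _) => [|A s IH] /=.
  by rewrite big_nil andbT.
by rewrite big_cons; case: (A \in S); rewrite ?leq_min IH //= andbCA.
Qed.

(** The cover is [Y], at least as large as [A], so the neutral element drops out of the minimum. *)
Lemma split_size_part (Y A : {set X}) : A \subset Y ->
  split_size (part_split Y A) = minn #|A| #|Y :\: A|.
Proof.
move=> AY; have cY : cover (part_split Y A) = Y.
  rewrite /cover bigcup_setU !big_set1 -[in RHS](setID Y A).
  by rewrite (setIidPr AY).
apply/eqP; rewrite eqn_leq leq_min leq_split_size cY.
have /andP[_ /forall_inP h] : _ && [forall A' in part_split Y A, _] :=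
  etrans (esym (leq_split_size (part_split Y A) _)) (leqnn _).
rewrite !h ?set21 ?set22 //=; apply/andP; split.
  by rewrite geq_min subset_leq_card.
apply/forall_inP=> B; rewrite !inE geq_min.
by case/orP=> /eqP ->; rewrite leqnn ?orbT.
Qed.

Lemma restricted_rsplitsP r Y S : 0 < r ->
  S \in restricted_rsplits SS r Y <->
  exists B, [/\ side B, S = part_split Y (Y :&: B)
                & minn #|Y :&: B| #|Y :\: B| = r].
Proof.
have imE B : [set A :&: Y | A in [set B; ~: B]] = part_split Y (Y :&: B).
  rewrite imsetU1 imset_set1 /part_split setDIr setDv set0U.
  by rewrite ![_ :&: Y]setIC setDE.
move=> r_gt0; rewrite inE; split.
  case/andP=> /imsetP[S0]; rewrite inE => /andP[S0X _] SE /eqP szS.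
  have /andP[_ /cards2P[B [C [_ S0E]]]] := splits_split S0X.
  have BS : B \in S0 by rewrite S0E set21.
  have sB : side B by apply/existsP; exists S0; rewrite S0X.
  have {}SE : S = part_split Y (Y :&: B) by rewrite SE (split_sides S0X BS) imE.
  exists B; split=> //.
  by rewrite -szS SE split_size_part ?subsetIl // setDIr setDv set0U.
case=> B [/sideP sB -> szB]; apply/andP; split; last first.
  by rewrite split_size_part ?subsetIl // setDIr setDv set0U szB.
apply/imsetP; exists [set B; ~: B]; last by rewrite imE.
rewrite inE sB; apply/forall_inP=> A; rewrite !inE -card_gt0 setIC.
(* A positive minimum makes both traces non-empty, as [restriction] requires. *)
move: r_gt0; rewrite -szB leq_min => /andP[B1 B2].
by case/orP=> /eqP->; rewrite // -setDE.
Qed.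

Lemma setI_seq (s : seq X) B : [set:: s] :&: B = [set:: filter (mem B) s].
Proof. by apply/setP=> x; rewrite !inE mem_filter andbC. Qed.

Lemma card_setI_seq (s : seq X) (B : {set X}) : uniq s ->
  #|[set:: s] :&: B| = count (mem B) s.
Proof.
by move=> us; rewrite setI_seq cardsE -size_filter; apply/card_uniqP/filter_uniq.
Qed.

Lemma weight_map (s : seq X) (B : {set X}) : uniq s ->
  weight (map (mem B) s) = minn #|[set:: s] :&: B| #|[set:: s] :\: B|.
Proof.
move=> us; rewrite setDE !card_setI_seq // /weight !count_map; congr minn.
by apply: eq_count => x /=; rewrite inE.
Qed.

(** * Counting restricted splits through masks *)

Definition mask_split (s : seq X) m := part_split [set:: s] [set:: mask m s].

Lemma mask_split_map (s : seq X) (B : {set X}) :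
  mask_split s (map (mem B) s) = part_split [set:: s] ([set:: s] :&: B).
Proof. by rewrite /mask_split setI_seq filter_mask. Qed.

Lemma part_splitC (Y B : {set X}) :
  part_split Y (Y :&: B) = part_split Y (Y :&: ~: B).
Proof. by rewrite /part_split !setDIr !setDv !set0U !setDE setCK setUC. Qed.

Lemma restricted_rsplits_maskP r (s : seq X) S : uniq s -> 0 < size s -> 0 < r ->
  S \in restricted_rsplits SS r [set:: s] <->
  exists m, [/\ m \in split_masks (size s) r, shows s m & S = mask_split s m].
Proof.
case: s => // x s us _ r_gt0; split.
  case/(restricted_rsplitsP _ _ r_gt0)=> B [sB SE szB].
  (* Of the two parts, the one containing the first point is the one that [split_masks] encodes. *)
  wlog xB : B sB SE szB / x \in B => [hB|].
    have [|xB] := boolP (x \in B); first exact: hB.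
    apply: (hB (~: B)); rewrite ?inE // ?sideC //; first by rewrite -part_splitC.
    by rewrite minnC -setDE setDE setCK.
  exists (map (mem B) (x :: s)); split; last by rewrite mask_split_map.
    by rewrite mem_split_masks // size_map eqxx weight_map // szB eqxx andbT.
  by apply/showsP; exists B.
case=> m []; rewrite mem_split_masks // => /and3P[_ _ /eqP wm] /showsP[B sB mE] ->.
apply/(restricted_rsplitsP _ _ r_gt0); exists B; split=> //.
  by rewrite -mE mask_split_map.
by rewrite -weight_map // mE.
Qed.

(** Both masks select the first point, so a part of one split cannot be the complement of the part
    selected by the other. *)
Lemma mask_split_inj n r (s : seq X) : uniq s -> size s = n -> 0 < n ->
  {in split_masks n r &, injective (mask_split s)}.
Proof.
move=> us; case: s us => [|x s] us <- // _ m m'.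
rewrite !mem_split_masks // => /and3P[/eqP sm hm _] /and3P[/eqP sm' hm' _] mm'.
have xin k : size k = size (x :: s) -> head false k -> x \in [set:: mask k (x :: s)].
  by case: k => // -[] k //= _ _; rewrite !inE eqxx.
rewrite -(map_mem_mask us sm) -(map_mem_mask us sm'); apply/eq_map => y /=.
have : [set:: mask m (x :: s)] \in mask_split (x :: s) m' by rewrite -mm' set21.
rewrite !inE => /orP[] /eqP/setP h; first by have := h y; rewrite !inE.
by have := h x; rewrite xin // !in_setD xin.
Qed.

Lemma card_restricted_rsplits r (s : seq X) : uniq s -> 0 < size s -> 0 < r ->
  #|restricted_rsplits SS r [set:: s]| = count (shows s) (split_masks (size s) r).
Proof.
move=> us s_gt0 r_gt0.
set L := [seq m <- split_masks (size s) r | shows s m].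
have -> : restricted_rsplits SS r [set:: s] = [set:: map (mask_split s) L].
  apply/setP=> S; rewrite [in RHS]inE; apply/idP/mapP.
    case/(restricted_rsplits_maskP _ us s_gt0 r_gt0)=> m [mM sm ->].
    by exists m; rewrite // mem_filter sm.
  case=> m; rewrite mem_filter => /andP[sm mM] ->.
  by apply/(restricted_rsplits_maskP _ us s_gt0 r_gt0); exists m.
rewrite cardsE -size_filter -[RHS](size_map (mask_split s)); apply/card_uniqP.
rewrite map_inj_in_uniq; first by rewrite filter_uniq ?split_masks_uniq.
move=> m m'; rewrite mem_filter => /andP[_ mM]; rewrite mem_filter => /andP[_].
exact: (mask_split_inj us erefl s_gt0 mM).
Qed.

(** * Separation of triples and medians *)

Lemma shows_separated s k k' m : shows s m ->
  majority k m != majority k' m -> separated (mask k s) (mask k' s).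
Proof.
case/showsP=> B sB <-; rewrite /majority -!map_mask !count_map => h.
by exists B.
Qed.

(** Passing to the complement flips both majorities, so a separating part may be assumed to contain
    the first point. *)
Lemma separated_shows (s : seq X) k k' : 0 < size s ->
  k \in triples (size s) -> k' \in triples (size s) ->
  separated (mask k s) (mask k' s) ->
  exists m, [/\ m \in split_masks (size s) (weight m), 1 < weight m, shows s m
              & majority k m != majority k' m].
Proof.
case: s => // x s _; rewrite !mem_triples.
move=> /andP[/eqP k3 /eqP sk] /andP[/eqP k'3 /eqP sk'] [B sB].
rewrite -!(count_map (mem B) id) !map_mask -/(majority k _) -/(majority k' _).
set m := map _ _ => mB; have sm : size m = (size s).+1 by rewrite size_map.
have hm : shows (x :: s) m by apply/showsP; exists B.
have wm : 1 < weight m by apply: weight_separating mB; rewrite ?sk ?sk' ?sm.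
have [xB|xB] := boolP (x \in B).
  by exists m; split; rewrite // mem_split_masks // sm !eqxx andbT.
exists (map negb m); split; last 1 first.
- by rewrite !majority_negb ?sk ?sk' ?sm // (inj_eq negb_inj).
- by rewrite mem_split_masks // size_map sm !eqxx andbT.
- by rewrite weight_negb.
- exact: shows_negb.
Qed.

(** In each split the median agrees with one of any two of the three point vertices, hence with at
    least two of the three. *)
Lemma median_majority x y z m (S : split_in SS) A :
  is_median (buneman_adj (SS := SS)) (point_vertex SS x) (point_vertex SS y)
    (point_vertex SS z) m ->
  A \in val S -> (val m S == A) = (1 < count (mem A) [:: x; y; z]).
Proof.
case=> /on_shortest_pathP/(_ S) xy /on_shortest_pathP/(_ S) yz.
move=> /on_shortest_pathP/(_ S) xz AS.
have pE u : (val (point_vertex SS u) S == A) = (u \in A).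
  apply/eqP/idP => [<-|uA]; first exact: mem_point_map.
  have /andP[/and3P[_ tS _] _] := splits_split (valP S).
  by rewrite /= ffunE (def_pblock tS AS uA).
have mE u : val m S = val (point_vertex SS u) S -> (val m S == A) = (u \in A).
  by move=> ->; apply: pE.
case: xy yz xz => /mE h1 [] /mE h2 [] /mE h3; move: h1 h2 h3; rewrite /=;
  by case: (_ == _); case: (x \in A); case: (y \in A); case: (z \in A).
Qed.

(** Distinct medians differ on some split, and a part picked by only one of them separates the
    triples by [median_majority]. *)
Lemma injective_separated : injective_system SS <->
  forall t t', uniq t -> uniq t' -> size t = 3 -> size t' = 3 ->
    [set:: t] != [set:: t'] -> separated t t'.
Proof.
have med x y z := median_unique_exists (point_vertex SS x) (point_vertex SS y)
  (point_vertex SS z).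
have set3 (x y z : X) : [set:: [:: x; y; z]] = [set x; y; z].
  by apply/setP=> u; rewrite !inE orbA.
split=> [inj t t' ut ut' st st' tt'|sep Y Y' Y3 Y'3 YY' m m'].
  case: t t' ut ut' st st' tt' => [|x [|y [|z []]]] // [|x' [|y' [|z' []]]] //.
  move=> ut ut' _ _ tt'.
  have [m [mm _]] := med x y z; have [m' [mm' _]] := med x' y' z'.
  have nmm' : m != m'.
    apply/eqP; apply: (inj [set:: [:: x; y; z]] [set:: [:: x'; y'; z']]).
    - by rewrite cardsE; apply/card_uniqP.
    - by rewrite cardsE; apply/card_uniqP.
    - exact/eqP.
    - by exists x, y, z; rewrite set3.
    - by exists x', y', z'; rewrite set3.
  have [S mS] : exists S, val m S != val m' S.
    apply/existsP; apply: contraT; rewrite negb_exists => /forallP h.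
    case/eqP: nmm'; apply/val_inj/ffunP=> S; apply/eqP.
    by have := h S; rewrite negbK.
  have mS_in := vertex_in m S.
  exists (val m S); first by apply/existsP; exists (val S); rewrite (valP S).
  rewrite -(median_majority mm mS_in) -(median_majority mm' mS_in).
  by rewrite eqxx [val m' S == _]eq_sym (negbTE mS).
move=> [x [y [z [YE Ym]]]] [x' [y' [z' [YE' Ym']]]] mm'.
have [B] : separated [:: x; y; z] [:: x'; y'; z'].
  apply: sep => //; last by rewrite !set3 -YE -YE'; apply/eqP.
    by apply/card_uniqP; rewrite -cardsE set3 -YE.
  by apply/card_uniqP; rewrite -cardsE set3 -YE'.
case/existsP=> S /andP[SX BS]; pose S' : split_in SS := exist _ S SX.
have BS' : B \in val S' by [].
by rewrite -(median_majority Ym BS') -(median_majority Ym' BS') mm' eqxx.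
Qed.

Lemma separated_perm t t' u u' : perm_eq t u -> perm_eq t' u' ->
  separated t t' -> separated u u'.
Proof. by move=> /permP tu /permP tu' [B sB]; rewrite tu tu'; exists B. Qed.

Lemma separatedC t t' : separated t t' -> separated t' t.
Proof. by case=> B sB h; exists B; rewrite // eq_sym. Qed.

(** * Separation in terms of the 2-splits present *)

Definition all_separated (s : seq X) := forall k k',
  k \in triples (size s) -> k' \in triples (size s) -> k != k' ->
  separated (mask k s) (mask k' s).

Lemma injective_all_separated s : injective_system SS -> uniq s -> all_separated s.
Proof.
move=> /injective_separated inj us k k'; rewrite !mem_triples.
move=> /andP[/eqP k3 /eqP sk] /andP[/eqP k'3 /eqP sk'] kk'.
apply: inj; rewrite ?mask_uniq ?size_mask //.
apply: contra kk' => /eqP/setP h; rewrite -(map_mem_mask us sk).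
rewrite -(map_mem_mask us sk'); apply/eqP/eq_map => x /=.
by have := h x; rewrite !inE.
Qed.

(** The weight hypothesis forces a split separating two triples to be a 2-split, hence a member of
    their constraint. *)
Lemma all_separated_hits s : 0 < size s -> all_separated s ->
  (forall m, m \in split_masks (size s) (weight m) -> 1 < weight m -> shows s m ->
    weight m = 2) ->
  hits (separators (size s)) (map (shows s) (split_masks (size s) 2)).
Proof.
move=> s_gt0 sep w2; apply/allP=> c; rewrite mem_undup => /allpairsPdep[k [k' []]].
move=> kT; rewrite mem_filter => /andP[kk' k'T] ->.
rewrite mask_mapb has_map.
have [m [mM wm sm km]] := separated_shows s_gt0 kT k'T (sep k k' kT k'T kk').
by apply/hasP; exists m; rewrite // mem_filter km -(w2 m).
Qed.

(** Pigeonhole: at most [n] of the 2-splits fail to separate the triples, and more than [n] are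
    present. *)
Lemma count_separated s k k' n :
  count (fun m => majority k m == majority k' m) (split_masks (size s) 2) <= n ->
  n < count (shows s) (split_masks (size s) 2) ->
  separated (mask k s) (mask k' s).
Proof.
move=> le_n gt_n; pose sep m := shows s m && (majority k m != majority k' m).
have [/hasP[m _ /andP[]]|/hasPn h] := boolP (has sep (split_masks (size s) 2)).
  exact: shows_separated.
suff le_h : count (shows s) (split_masks (size s) 2)
    <= count (fun m => majority k m == majority k' m) (split_masks (size s) 2).
  by have := leq_trans gt_n (leq_trans le_h le_n); rewrite ltnn.
rewrite -!size_filter; apply: uniq_leq_size.
  by rewrite filter_uniq ?split_masks_uniq.
move=> m; rewrite mem_filter => /andP[sm mM]; rewrite mem_filter mM andbT.
by have := h m mM; rewrite /sep sm negbK.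
Qed.

(** * Triangles of 2-splits *)

Lemma triangle_part s k u v : uniq s -> 3 < size s -> size k = size s ->
  {in split_masks (size s) 2, forall m,
     constant (mask (map negb k) m) -> shows s m} ->
  u \in mask k s -> v \in mask k s -> u != v ->
  part_split [set:: s] [set u; v] \in restricted_rsplits SS 2 [set:: s].
Proof.
move=> us s4 sk kP uk vk uv; pose A : {set X} := [set u; v].
have sA : [set:: s] :&: A = A.
  apply/setIidPr/subsetP=> x; rewrite !inE => /orP[] /eqP->.
    exact: mem_mask uk.
  exact: mem_mask vk.
have cA : #|[set:: s] :\: A| = size s - 2.
  by rewrite cardsD sA cards2 uv cardsE (card_uniqP us).
have w2 : weight (map (mem A) s) = 2.
  rewrite weight_map // sA cA cards2 uv; apply/minn_idPl.
  by rewrite leq_subRL ?(ltnW (ltnW s4)).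
have nA : mask (map negb k) (map (mem A) s)
    = nseq (size (mask (map negb k) s)) false.
  rewrite -map_mask -(size_map (mem A)); apply/all_pred1P.
  rewrite all_map; apply/allP=> x xk /=.
  rewrite eqbF_neg !inE; apply/norP; split; apply: contraTneq xk => ->.
    exact: mask_negb_notin uk.
  exact: mask_negb_notin vk.
(* The bits of [A] vanish outside the triple, so [kP] applies, after complementing if the first
   point is not in [A]. *)
have shA : shows s (map (mem A) s).
  case: s us s4 sk kP uk vk sA cA w2 nA => // x s us _ sk kP _ _ _ _ w2 nA.
  have [xA|xA] := boolP (x \in A).
    apply: kP; last by rewrite nA constant_nseq.
    by rewrite mem_split_masks // size_map w2 !eqxx andbT.
  rewrite -[map _ _](mapK negbK); apply: shows_negb; apply: kP.
    by rewrite mem_split_masks // weight_negb !size_map w2 !eqxx andbT.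
  by rewrite -map_mask nA map_nseq constant_nseq.
have [B sB mB] := showsP _ _ shA.
have AB : [set:: s] :&: B = A by rewrite -sA !setI_seq !filter_mask mB.
apply/restricted_rsplitsP => //; exists B; split=> //; first by rewrite AB.
by rewrite -weight_map // mB.
Qed.

(** The part with trace [[set u; v]] holds two points of [t] and none of [t']. *)
Lemma pair_separated (t t' : seq X) u v : uniq (t ++ t') ->
  u \in t -> v \in t -> u != v ->
  part_split [set:: t ++ t'] [set u; v] \in restricted_rsplits SS 2 [set:: t ++ t'] ->
  separated t t'.
Proof.
rewrite cat_uniq => /and3P[ut tt' ut'] uk vk uv.
case/restricted_rsplitsP=> // B [sB SE _].
wlog AE : B sB SE / [set u; v] = [set:: t ++ t'] :&: B => [h|].
  have : [set u; v] \in part_split [set:: t ++ t'] ([set:: t ++ t'] :&: B).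
    by rewrite -SE set21.
  rewrite !inE => /orP[] /eqP AE; first exact: h AE.
  apply: (h (~: B)); rewrite ?sideC -?part_splitC //.
  by rewrite AE setDIr setDv set0U setDE.
have inB x : x \in t ++ t' -> (x \in B) = (x == u) || (x == v).
  by move=> xt; have /setP/(_ x) := AE; rewrite !inE xt.
exists B => //; have -> : 1 < count (mem B) t.
  rewrite -size_filter; apply: (@uniq_leq_size _ [:: u; v]).
    by rewrite /= inE uv.
  move=> x; rewrite !inE mem_filter => xuv.
  have xt : x \in t by case/orP: xuv => /eqP->.
  by rewrite xt /= inB ?mem_cat ?xt // xuv.
have /eqP -> // : count (mem B) t' == 0.
rewrite -leqn0 leqNgt -has_count; apply/hasPn=> x xt' /=.
rewrite inB ?mem_cat ?xt' ?orbT //; apply/norP.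
by split; apply: contraNneq tt' => xE; apply/hasP; exists x; rewrite //= xE.
Qed.

(** Two of the three vertices of the triangle lie in the same triple, and the edge joining them
    separates. *)
Lemma triangle_separated (t t' : seq X) : uniq (t ++ t') ->
  has_triangle SS [set:: t ++ t'] -> separated t t'.
Proof.
move=> utt' [x [y [z [[xt yt zt] [xy xz yz] [Sxy Sxz Syz]]]]].
move: xt yt zt; rewrite !inE !mem_cat => xt yt zt.
have E : [set:: t ++ t'] = [set:: t' ++ t].
  by apply/setP=> w; rewrite !inE !mem_cat orbC.
have side2 u v : u != v ->
    part_split [set:: t ++ t'] [set u; v]
      \in restricted_rsplits SS 2 [set:: t ++ t'] ->
    (u \in t) && (v \in t) || (u \in t') && (v \in t') -> separated t t'.
  move=> uv Suv /orP[] /andP[uin vin]; first exact: pair_separated Suv.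
  rewrite E in Suv; apply: separatedC.
  by apply: pair_separated Suv; rewrite // uniq_catC.
have := side2 x y xy Sxy; have := side2 x z xz Sxz; have := side2 y z yz Syz.
by case/orP: xt => ->; case/orP: yt => ->; case/orP: zt => ->;
  rewrite ?orbT //=; move=> h1 h2 h3;
  first [by apply: h1|by apply: h2|by apply: h3].
Qed.

End Sides.

(** * Injectivity against dicing on 4, 5 and 6 points *)

Theorem theorem2 (X : finType) (hX : 3 <= #|X|) (SS : split_system X) :
  injective_system SS <-> dices4 SS /\ dices5 SS /\ dices6 SS.
Proof.
have enumY (Y : {set X}) : [set:: enum Y] = Y by rewrite set_enum.
have count_id s M : count id (map (shows SS s) M) = count (shows SS s) M.
  by rewrite count_map.
split=> [inj|[d4 [d5 d6]]].
  have sep (Y : {set X}) := injective_all_separated inj (enum_uniq Y).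
  (* On at most five points the smaller part has at most two points. *)
  have weight2 n m : 0 < n < 6 -> m \in split_masks n (weight m) ->
      1 < weight m -> weight m = 2.
    case/andP=> n_gt0 n_lt6; rewrite mem_split_masks // => /and3P[/eqP sm _ _].
    move: (weight_double m); rewrite sm => /leq_ltn_trans/(_ n_lt6).
    by case: (weight m) => [|[|[|?]]].
  split; [|split]; right=> Y Y_n; have sY := cardE Y; rewrite Y_n in sY.
  - rewrite -(enumY Y) card_restricted_rsplits -?sY ?enum_uniq // -count_id.
    apply: (checksP checks4); first by rewrite size_map.
    rewrite sY; apply: all_separated_hits; rewrite -?sY // => m mM + _.
    exact: weight2 mM.
  - rewrite -(enumY Y) card_restricted_rsplits -?sY ?enum_uniq // -count_id.
    apply: (checksP checks5); first by rewrite size_map.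
    rewrite sY; apply: all_separated_hits; rewrite -?sY // => m mM + _.
    exact: weight2 mM.
  rewrite -(enumY Y) card_restricted_rsplits -?sY ?enum_uniq // -has_count.
  case: hasP => [|no3]; [by left|right].
  (* Without 3-splits, every non-trivial split shown on six points is a 2-split. *)
  have : hits (separators 6) (map (shows SS (enum Y)) (split_masks 6 2)).
    rewrite {1 2}sY; apply: all_separated_hits; rewrite -?sY //.
    move=> m mM w_gt1 sm; move: mM (weight_double m); rewrite mem_split_masks //.
    case/and3P=> /eqP szm hm _; rewrite szm.
    case w : (weight m) w_gt1 => [|[|[|[|?]]]] // _ _.
    by case: no3; exists m; rewrite // mem_split_masks // szm hm w.
  move/(checksP checks6); rewrite size_map => /(_ erefl)/hasP[c /mapP[k]].
  rewrite mem_triples => /andP[/eqP k3 /eqP sk] ->; rewrite mask_mapb all_map => kP.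
  have sk' : size k = size (enum Y) by rewrite sk.
  have := size_mask sk'; have := mask_uniq (enum_uniq Y) k; rewrite k3.
  case E : (mask k _) => [|x [|y [|z []]]] // u3 _; exists x, y, z.
  have part u v : u \in [:: x; y; z] -> v \in [:: x; y; z] -> u != v ->
      part_split [set:: enum Y] [set u; v]
        \in restricted_rsplits SS 2 [set:: enum Y].
    rewrite -E; apply: triangle_part; rewrite ?enum_uniq -?sY // => m mM cm.
    by move/allP: kP; apply; rewrite mem_filter cm.
  have inY u : u \in [:: x; y; z] -> u \in [set:: enum Y].
    by rewrite -E inE; apply: mem_mask.
  have /and3P[xy xz yz] : [&& x != y, x != z & y != z].
    by move: u3; rewrite /= !inE andbT negb_or -andbA.
  split; [split; apply: inY|by split|split; apply: part];
    by rewrite // !in_cons eqxx ?orbT.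
apply/injective_separated=> t t' ut ut' st st' tt'.
(* Reordering the triples as [u ++ v] and [u ++ v'], with [u] the common points, lists their union
   as [u ++ v ++ v']. *)
pose u := filter (mem t') t; pose v := filter (predC (mem t')) t.
pose v' := filter (predC (mem t)) t'.
have pt : perm_eq (u ++ v) t by apply/permPl/perm_filterC.
have pt' : perm_eq (u ++ v') t'.
  apply: (@perm_trans _ (filter (mem t) t' ++ v')); last exact/permPl/perm_filterC.
  rewrite perm_cat2r; apply: uniq_perm; rewrite ?filter_uniq // => x.
  by rewrite !mem_filter andbC.
have us : uniq (u ++ v ++ v').
  rewrite catA cat_uniq (perm_uniq pt) ut filter_uniq // andbT.
  by apply/hasPn=> x; rewrite mem_filter (perm_mem pt) => /andP[].
have cardY (s : seq X) : uniq s -> #|[set:: s]| = size s.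
  by move=> /card_uniqP <-; rewrite cardsE.
have nocard (s : seq X) : uniq s -> ~ #|X| < size s.
  by move=> /cardY <-; rewrite ltnNge max_card.
apply: (separated_perm pt pt').
have su : size u + size v = 3 by rewrite -size_cat (perm_size pt).
have su' : size u + size v' = 3 by rewrite -size_cat (perm_size pt').
have u_lt3 : size u < 3.
  rewrite ltnNge; apply: contra tt' => u_ge3.
  have nil (w : seq X) : size u + size w = 3 -> w = [::].
    by move: u_ge3; case: w (size u) => // ? ? [|[|[|?]]] // _; rewrite addnS.
  apply/eqP/setP=> x.
  by rewrite !inE -(perm_mem pt) -(perm_mem pt') (nil v su) (nil v' su').
move: us su su' u_lt3; clear pt pt'; clearbody u v v'.
case: u => [|a [|b []]] //.
- case: v v' => [|a [|b [|c []]]] // [|d [|e [|f []]]] // us _ _ _.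
  have cY := cardY _ us; case: d6 => [/(nocard _ us)//|/(_ _ cY)[]]; last first.
    exact: (@triangle_separated X SS [:: a; b; c] [:: d; e; f] us).
  rewrite card_restricted_rsplits // -has_count => /hasP[m mM sm].
  apply: (shows_separated (k := [:: true; true; true; false; false; false])
                          (k' := [:: false; false; false; true; true; true]) sm).
  (* Each part of a 3-split holds the majority of exactly one of two complementary triples. *)
  have /allP : all (fun m => majority [:: true; true; true; false; false; false] m !=
    majority [:: false; false; false; true; true; true] m) (split_masks 6 3).
    by vm_compute.
  exact.
- case: v v' => [|b [|c []]] // [|d [|e []]] // us _ _ _.
  (* The four 2-splits that fail to separate [abc] from [ade] are the edges [bd], [be], [cd],
     [ce]. *)
  apply: (@count_separated X SS [:: a; b; c; d; e]
    [:: true; true; true; false; false] [:: true; false; false; true; true] 4).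
    by vm_compute.
  rewrite -card_restricted_rsplits //.
  by case: d5 => [/(nocard _ us)//|]; apply; rewrite cardY.
case: v v' => [|c []] // [|d []] // us _ _ _.
(* Only [ab|cd] fails to separate [abc] from [abd]. *)
apply: (@count_separated X SS [:: a; b; c; d]
  [:: true; true; true; false] [:: true; true; false; true] 1); first by vm_compute.
rewrite -card_restricted_rsplits //.
by case: d4 => [/(nocard _ us)//|]; apply; rewrite cardY.
Qed.
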